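(* If $t\mapsto Q_t$ and $t\mapsto\mathrm T_t$ are continuous at a given $t_0\in[0,1]$, then $$\big\|(\mathcal A_t-\mathbf i)^{-1}-(\mathcal A_{t_0}-\mathbf i)^{-1}\big\|_{\mathcal B(\mathcal H,\mathcal H_+)}=o(1),\quad t\to t_0.$$
   Context: Inner products are linear in the first argument. $\mathcal H,\mathfrak H$ are complex separable Hilbert spaces; $A$ is a densely defined, closed, symmetric operator in $\mathcal H$ with equal (possibly infinite) deficiency indices; $\mathcal H_+:=\mathrm{dom}(A^* )$ carries the graph inner product $\langle u,v\rangle_{\mathcal H}+\langle A^*u,A^*v\rangle_{\mathcal H}$. For each $t\in[0,1]$: $\mathrm T_t=[\Gamma_{0t},\Gamma_{1t}]^\top\in\mathcal B(\mathcal H_+,\mathfrak H\times\mathfrak H)$ and $(\mathfrak H,\Gamma_{0t},\Gamma_{1t})$ is an ordinary boundary triplet, i.e. $\mathrm T_t$ is surjective and $\langle A^*u,v\rangle_{\mathcal H}-\langle u,A^*v\rangle_{\mathcal H}=\langle\Gamma_{1t}u,\Gamma_{0t}v\rangle_{\mathfrak H}-\langle\Gamma_{0t}u,\Gamma_{1t}v\rangle_{\mathfrak H}$ for all $u,v\in\mathcal H_+$; $Q_t$ is an orthogonal projection in $\mathfrak H\times\mathfrak H$ whose range is Lagrangian with respect to $\omega((f_1,f_2)^\top,(g_1,g_2)^\top)=\langle f_2,g_1\rangle_{\mathfrak H}-\langle f_1,g_2\rangle_{\mathfrak H}$ (i.e. it equals its own $\omega$-annihilator); $\mathcal A_t$ is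 a self-adjoint extension of $A$ with $\mathrm T_t(\mathrm{dom}(\mathcal A_t))=\mathrm{ran}(Q_t)$. Continuity is in the norms of $\mathcal B(\mathfrak H\times\mathfrak H)$ and $\mathcal B(\mathcal H_+,\mathfrak H\times\mathfrak H)$. *)

(* Defs.v *)
From HB Require Import structures.
From mathcomp Require Import all_boot all_order all_algebra.
From mathcomp Require Import sesquilinear.
From mathcomp Require Export complex.
From mathcomp Require Import all_classical all_reals all_analysis.
Set Implicit Arguments.
Unset Strict Implicit.
Unset Printing Implicit Defensive.
Import Order.TTheory GRing.Theory Num.Theory.
Import numFieldNormedType.Exports.
Local Open Scope classical_set_scope.
Local Open Scope ring_scope.

(* Complex Hilbert spaces. A form in [{dot H for Num.conj}] is positive
   definite, linear in its FIRST argument and conjugate-linear in the second. *)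
HB.mixin Record CompleteNormedModule_isHilbert (R : realType) (H : Type)
    of CompleteNormedModule R[i] H := {
  hdot : {dot H for (Num.conj : R[i] -> R[i])};
  sqr_norm_hdot : forall u : H, `|u| ^+ 2 = hdot u u
}.

#[short(type="hilbertType")]
HB.structure Definition Hilbert (R : realType) :=
  { H of CompleteNormedModule_isHilbert R H & CompleteNormedModule R[i] H }.

Definition separable (T : topologicalType) : Prop :=
  exists2 S : set T, countable S & dense S.

Section OperatorNorm.
Context {R : realType}.

Definition dot_norm (V : Type) (ip : V -> V -> R[i]) (u : V) : R :=
  Num.sqrt (complex.Re (ip u u)).

(* The norm of the restriction of [T] to [D], for the norms given by the inner
   products [ipV] and [ipW]; it is +oo when this restriction is unbounded. The
   values of [T] outside [D] are irrelevant. *)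
Definition opnorm (V W : Type) (D : set V) (ipV : V -> V -> R[i])
    (ipW : W -> W -> R[i]) (T : V -> W) : \bar R :=
  ereal_sup [set (dot_norm ipW (T u))%:E | u in D `&` [set u | dot_norm ipV u <= 1]].

Definition subspace_set (V : lmodType R[i]) (D : set V) : Prop :=
  D 0 /\ forall (a : R[i]) (u v : V), D u -> D v -> D (a *: u + v).

Definition linear_on (V W : lmodType R[i]) (D : set V) (T : V -> W) : Prop :=
  forall (a : R[i]) (u v : V), D u -> D v -> T (a *: u + v) = a *: T u + T v.

Record bounded_op (V W : lmodType R[i]) (D : set V) (ipV : V -> V -> R[i])
    (ipW : W -> W -> R[i]) (T : V -> W) : Prop := BoundedOp {
  bounded_op_linear : linear_on D T;
  bounded_op_opnorm : (opnorm D ipV ipW T < +oo)%E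
}.

End OperatorNorm.

Section UnboundedOperators.
Context {R : realType} (H : hilbertType R).
Implicit Types (A B : H -> H).

(* [app] is meaningful on [dom] only. *)
Record operator := Operator { dom : set H; app :> H -> H }.

Implicit Types S T : operator.

Definition linear_operator S : Prop := subspace_set (dom S) /\ linear_on (dom S) S.

Definition densely_defined S : Prop := dense (dom S).

Definition closed_operator S : Prop :=
  closed [set p : H * H | dom S p.1 /\ p.2 = S p.1].

Definition symmetric_operator S : Prop :=
  forall u v : H, dom S u -> dom S v -> hdot (S u) v = hdot u (S v).

Definition extends S T : Prop :=
  dom S `<=` dom T /\ forall u : H, dom S u -> T u = S u.

(* When [S] is densely defined, [xget] chooses among at most one vector. *)
Definition adjoint S : operator :=
  let adj_rel (u w : H) := forall x : H, dom S x -> hdot (S x) u = hdot x w in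
  Operator [set u | exists w : H, adj_rel u w] (fun u => xget 0 (adj_rel u)).

Definition self_adjoint S : Prop := extends S (adjoint S) /\ extends (adjoint S) S.

(* [(S - z)^-1]; [xget] is applied to a singleton for [z] in the resolvent set
   of [S], in particular for [z = 'i] when [S] is self-adjoint. *)
Definition resolvent S (z : R[i]) : H -> H :=
  fun f => xget 0 [set u | dom S u /\ S u - z *: u = f].

(* The inner product of [dom (adjoint S)] as a Hilbert space. *)
Definition graph_dot S (u v : H) : R[i] :=
  hdot u v + hdot (adjoint S u) (adjoint S v).

Definition lin_span (E : set H) : set H :=
  [set u | exists n (a : 'I_n -> R[i]) (e : 'I_n -> H),
      (forall i, E (e i)) /\ u = \sum_(i < n) a i *: e i].

Definition orthonormal_set (E : set H) : Prop :=
  (forall e : H, E e -> hdot e e = 1) /\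
  (forall e f : H, E e -> E f -> e != f -> hdot e f = 0).

Definition orthonormal_basis (N E : set H) : Prop :=
  orthonormal_set E /\ closure (lin_span E) = N.

Definition same_dimension (N M : set H) : Prop :=
  exists E F : set H,
    [/\ orthonormal_basis N E, orthonormal_basis M F & (E #= F)%card].

Definition deficiency_space S (z : R[i]) : set H :=
  [set u | dom (adjoint S) u /\ adjoint S u = z *: u].

Definition equal_deficiency_indices S : Prop :=
  same_dimension (deficiency_space S 'i) (deficiency_space S (- 'i)).

End UnboundedOperators.

Section BoundaryTriplets.
Context {R : realType} (H G : hilbertType R).

(* The product norm of the library on [G * G] is the max norm; the Hilbert space
   structure used on [G * G] is given by this inner product instead. *)
Definition prod_dot (x y : G * G) : R[i] := hdot x.1 y.1 + hdot x.2 y.2.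

Definition omega (x y : G * G) : R[i] := hdot x.2 y.1 - hdot x.1 y.2.

Definition lagrangian (L : set (G * G)) : Prop :=
  L = [set x | forall y : G * G, L y -> omega x y = 0].

Definition orthogonal_projection (Q : {linear (G * G)%type -> (G * G)%type}) : Prop :=
  (forall x, Q (Q x) = Q x) /\ (forall x y, prod_dot (Q x) y = prod_dot x (Q y)).

Definition trace_op (Gamma0 Gamma1 : H -> G) (u : H) : G * G := (Gamma0 u, Gamma1 u).

Record boundary_triplet (A : operator H) (Gamma0 Gamma1 : H -> G) : Prop := BoundaryTriplet {
  trace_bounded : bounded_op (dom (adjoint A)) (graph_dot A) prod_dot (trace_op Gamma0 Gamma1);
  trace_surjective : trace_op Gamma0 Gamma1 @` dom (adjoint A) = setT;
  green_identity : forall u v : H, dom (adjoint A) u -> dom (adjoint A) v ->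
    hdot (adjoint A u) v - hdot u (adjoint A v) =
    hdot (Gamma1 u) (Gamma0 v) - hdot (Gamma0 u) (Gamma1 v)
}.

(* Convergence in the norm [opnorm D ipV ipW] of the family [T], defined on
   [0, 1], as its parameter tends to [t0]. *)
Definition cvg_opnorm01 (V : Type) (W : zmodType) (D : set V) (ipV : V -> V -> R[i])
    (ipW : W -> W -> R[i]) (T : R -> V -> W) (t0 : R) : Prop :=
  opnorm D ipV ipW (fun u => T t u - T t0 u) @[t --> within `[0, 1]%classic (nbhs t0)] --> 0%E.

End BoundaryTriplets.

(* Main.v *)
(** Let [u t] be the resolvent of [cA t] at ['i] applied to [f], and [w] the
    difference [u t - u t0]. Then [w] is in the kernel of [A^* - 'i], so Green's
    identity gives [2 'i |w|^2 = omega (T_t w) (T_t w)]. Now [T_t (u t)] lies in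
    the isotropic space [ran Q_t], and so does [Q_t (T_t0 (u t0))], which is close
    to [T_t0 (u t0) = Q_t0 (T_t0 (u t0))] and hence to [T_t (u t0)]. So [T_t w] is
    close to an isotropic vector, which makes [omega (T_t w) (T_t w)] small,
    uniformly in [f] in the unit ball. *)
Require Import Defs.
From mathcomp Require Import all_boot all_order all_algebra.
From mathcomp Require Import sesquilinear ring lra.
From mathcomp Require Import all_classical all_reals all_analysis.
Import Order.TTheory GRing.Theory Num.Theory.
Import numFieldNormedType.Exports.
Local Open Scope classical_set_scope.
Local Open Scope ring_scope.

Set Implicit Arguments.
Unset Strict Implicit.
Unset Printing Implicit Defensive.

Local Notation hnorm := (dot_norm (@hdot _ _)).
Local Notation cmod := ComplexField.Normc.normc.
Local Notation "x %:C" := (real_complex _ x) : ring_scope.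

(** * Real-valued norm and inner product identities in a complex Hilbert space *)

Section HilbertSpace.
Context {R : realType} {H : hilbertType R}.
Implicit Types (u v w : H) (z : R[i]).

(** The library norm takes values in [R[i]]; passing to the real [hnorm] allows estimates to be
    carried out over [R]. *)
Lemma normr_hnorm u : `|u| = (hnorm u)%:C.
Proof.
have /complex_realP[r ru] : `|u| \is Num.real by exact: normr_real.
have r0 : 0 <= r by rewrite -ler0c -ru.
by rewrite /dot_norm -sqr_norm_hdot ru -rmorphXn /= sqrtr_sqr ger0_norm.
Qed.

Lemma hnorm_ge0 u : 0 <= hnorm u. Proof. exact: sqrtr_ge0. Qed.

Lemma hdot_hnorm u : hdot u u = (hnorm u ^+ 2)%:C.
Proof. by rewrite -sqr_norm_hdot normr_hnorm rmorphXn. Qed.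

Lemma hnormD u v : hnorm (u + v) <= hnorm u + hnorm v.
Proof. by rewrite -lecR rmorphD /= -!normr_hnorm ler_normD. Qed.

Lemma hnormN u : hnorm (- u) = hnorm u.
Proof. by apply: complexI; rewrite -!normr_hnorm normrN. Qed.

Lemma hnorm0 : hnorm (0 : H) = 0.
Proof. by apply: complexI; rewrite -normr_hnorm normr0. Qed.

Lemma hnormZ z u : hnorm (z *: u) = cmod z * hnorm u.
Proof. by apply: complexI; rewrite rmorphM /= -!normr_hnorm normrZ. Qed.

Lemma hnorm0_eq0 u : hnorm u = 0 -> u = 0.
Proof. by move=> u0; apply/eqP; rewrite -normr_eq0 normr_hnorm u0. Qed.

Lemma hdotC u v : hdot v u = (hdot u v)^*.
Proof. by rewrite hermC expr0 mul1r. Qed.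

Lemma normr_cmod z : `|z| = (cmod z)%:C. Proof. by []. Qed.

Lemma cmod_ge0 z : 0 <= cmod z.
Proof. by rewrite -ler0c -normr_cmod. Qed.

Lemma ler_cmodD z1 z2 : cmod (z1 + z2) <= cmod z1 + cmod z2.
Proof. exact: le_normcD. Qed.

Lemma hdotJ u v : hdot u v * hdot v u = (cmod (hdot u v) ^+ 2)%:C.
Proof. by rewrite (hdotC u v) -normCK normr_cmod -rmorphXn. Qed.

Lemma conjC_realM (r : R) z : (r%:C * z)^* = r%:C * z^*.
Proof.
by rewrite rmorphM /= (@conj_Creal _ r%:C) //; apply/complex_realP; exists r.
Qed.

Lemma hdotDl u v w : hdot (u + v) w = hdot u w + hdot v w.
Proof. exact: linearDl. Qed.

Lemma hdotDr u v w : hdot u (v + w) = hdot u v + hdot u w.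
Proof. exact: linearDr. Qed.

Lemma hdotBl u v w : hdot (u - v) w = hdot u w - hdot v w.
Proof. exact: linearBl. Qed.

Lemma hdotBr u v w : hdot u (v - w) = hdot u v - hdot u w.
Proof. exact: linearBr. Qed.

Lemma hdotZl z u v : hdot (z *: u) v = z * hdot u v.
Proof. exact: linearZl_LR. Qed.

Lemma hdotZr z u v : hdot u (z *: v) = z^* * hdot u v.
Proof. exact: linearZr_LR. Qed.

(** The coefficient [s] is left free: [|v|^-2] yields Cauchy-Schwarz, and [(|v|^2 + 1)^-1] yields
    the orthogonality of a minimizer. *)
Lemma sqr_hnormB_proj u v (s : R) :
  hnorm (u - (s%:C * hdot u v) *: v) ^+ 2 =
  hnorm u ^+ 2 - 2 * s * cmod (hdot u v) ^+ 2
  + s ^+ 2 * cmod (hdot u v) ^+ 2 * hnorm v ^+ 2.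
Proof.
apply: complexI; rewrite -hdot_hnorm hdotBl !hdotBr !hdotZl !hdotZr.
rewrite !conjC_realM -hdotC !hdot_hnorm.
have := hdotJ u v; set p := cmod _ => pE.
rewrite (rmorphD (real_complex R)) (rmorphB (real_complex R)).
rewrite !(rmorphM (real_complex R)) (rmorph_nat (real_complex R) 2) in pE *.
ring : pE.
Qed.

(** Cauchy-Schwarz: the component of [u] orthogonal to [v] has nonnegative squared norm. *)
Lemma cmod_hdot_le u v : cmod (hdot u v) <= hnorm u * hnorm v.
Proof.
have [/hnorm0_eq0 ->|v0] := eqVneq (hnorm v) 0.
  rewrite linear0r ComplexField.Normc.normc0 mulr_ge0 ?hnorm_ge0 //.
have vp : 0 < hnorm v by rewrite lt_neqAle eq_sym v0 hnorm_ge0.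
rewrite -ler_sqr ?nnegrE ?mulr_ge0 ?hnorm_ge0 ?cmod_ge0 //.
have := sqr_ge0 (hnorm (u - ((hnorm v ^- 2)%:C * hdot u v) *: v)).
rewrite sqr_hnormB_proj; set p := cmod _ => h.
rewrite exprMn -ler_pdivrMr ?exprn_gt0 // -subr_ge0.
apply: le_trans h _; rewrite le_eqVlt; apply: predU1l.
by field.
Qed.

Lemma hnorm_parallelogram u v :
  hnorm (u + v) ^+ 2 + hnorm (u - v) ^+ 2 = 2 * (hnorm u ^+ 2 + hnorm v ^+ 2).
Proof.
have hE w : hdot w w = (hnorm w)%:C ^+ 2 by rewrite hdot_hnorm rmorphXn.
apply: complexI.
have -> : (hnorm (u + v) ^+ 2 + hnorm (u - v) ^+ 2)%:C =
    hdot (u + v) (u + v) + hdot (u - v) (u - v).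
  by rewrite !hE rmorphD !rmorphXn.
have -> : (2 * (hnorm u ^+ 2 + hnorm v ^+ 2))%:C = 2 * (hdot u u + hdot v v).
  by rewrite !hE -!rmorphXn -rmorphD -(rmorph_nat (real_complex R)) -rmorphM.
rewrite hdotBl hdotDl !hdotBr !hdotDr; ring.
Qed.

Lemma hnormMi u : hnorm ('i *: u) = hnorm u.
Proof.
rewrite hnormZ -[RHS]mul1r; congr (_ * _).
by apply: complexI; rewrite -normr_cmod normCi.
Qed.

End HilbertSpace.

(** * Adjoints, self-adjoint operators and surjectivity of [S - 'i] *)

Section SelfAdjoint.
Context {R : realType} {H : hilbertType R}.
Implicit Types (S : operator H) (u v w f : H).

Lemma hnorm_cauchy_cvg (s : nat -> H) :
  (forall e : R, 0 < e -> exists N, forall m n, (N <= m)%N -> (N <= n)%N ->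
     hnorm (s m - s n) < e) ->
  exists l, forall e : R, 0 < e -> \forall n \near \oo, hnorm (s n - l) < e.
Proof.
move=> scauchy; have /cauchy_cvgP : cauchy (s @ \oo).
  apply/cauchy_ballP => e e0.
  (* A positive element of [R[i]] is real, so entourages reduce to real radii. *)
  have eE : e = (complex.Re e)%:C by rewrite RRe_real // gtr0_real.
  have [N sN] : exists N, forall m n, (N <= m)%N -> (N <= n)%N ->
      hnorm (s m - s n) < complex.Re e.
    by apply: scauchy; rewrite -ltcR -eE.
  exists ([set s n | n in [set n | (N <= n)%N]], [set s n | n in [set n | (N <= n)%N]]).
    by split; exists N => //= n Nn; exists n.
  move=> [_ _] [/= [m Nm <-] [n Nn <-]].
  by rewrite -ball_normE /= normr_hnorm eE ltcR sN.
move=> /cvg_ex[l sl]; exists l => e e0.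
have e0' : 0 < e%:C by rewrite ltcR.
have [N _ sN] := (@cvgrPdist_lt _ _ _ _ _ _ _).1 sl _ e0'.
by exists N => // n /sN /=; rewrite -opprB normrN normr_hnorm ltcR.
Qed.

(** If [w = u - v] were nonzero, some [x] in [D] would satisfy [|w - x| < |w|]; since [x] is
    orthogonal to [w], Cauchy-Schwarz gives [|w|^2 <= |w - x| |w|], a contradiction. *)
Lemma dense_hdot_inj (D : set H) u v : dense D ->
  (forall x, D x -> hdot x u = hdot x v) -> u = v.
Proof.
move=> Dd Duv; apply/eqP; rewrite -subr_eq0; set w := u - v.
apply/negPn/negP => w0.
have wp : 0 < `|w| by rewrite normr_gt0.
have [|x [wx Dx]] := Dd (ball w `|w|) _ (ball_open w `|w|).
  by exists w; exact: ballxx.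
have xw : hdot x w = 0 by rewrite hdotBr Duv // subrr.
have : hnorm w ^+ 2 <= hnorm (w - x) * hnorm w.
  apply: le_trans (cmod_hdot_le _ _); rewrite hdotBl xw subr0 hdot_hnorm.
  by rewrite -lecR -normr_cmod ger0_norm // lecR exprn_ge0 // hnorm_ge0.
move: wx wp; rewrite -ball_normE /= !normr_hnorm ltcR => wx.
by rewrite ltcR => wp; rewrite expr2 ler_pM2r // leNgt wx.
Qed.

Lemma adjoint_hdot S u v : dom S u -> dom (adjoint S) v ->
  hdot (S u) v = hdot u (adjoint S v).
Proof.
move=> Su Sv; exact: (xgetPex 0 Sv).
Qed.

(** Density makes the vector selected by [xget] in [adjoint] unique. *)
Lemma adjoint_eq S v w : densely_defined S ->
  (forall u, dom S u -> hdot (S u) v = hdot u w) ->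
  dom (adjoint S) v /\ adjoint S v = w.
Proof.
move=> Sd Svw; have Sv : dom (adjoint S) v by exists w.
by split => //; apply: (dense_hdot_inj Sd) => u Su; rewrite -adjoint_hdot// Svw.
Qed.

Lemma self_adjoint_symmetric S : self_adjoint S -> symmetric_operator S.
Proof. by move=> [[SS' SE] _] u v Su Sv; rewrite adjoint_hdot ?SE//; exact: SS'. Qed.

Lemma self_adjoint_eq S v w : densely_defined S -> self_adjoint S ->
  (forall u, dom S u -> hdot (S u) v = hdot u w) -> dom S v /\ S v = w.
Proof.
by move=> Sd [_ [SS' SE]] /(adjoint_eq Sd)[Sv <-]; split; [exact: SS'|rewrite SE].
Qed.

(** Taking adjoints reverses inclusions: [S = S^*] is contained in [A^*]. *)
Lemma extends_adjoint (A S : operator H) u : densely_defined A -> self_adjoint S ->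
  extends A S -> dom S u -> dom (adjoint A) u /\ adjoint A u = S u.
Proof.
move=> Ad Ssa [AS SE] Su; apply: adjoint_eq => // x Ax.
by rewrite -SE// self_adjoint_symmetric//; exact: AS.
Qed.

(** The cross terms cancel by symmetry, so [S - 'i] is isometric from the graph norm of [S] to the
    norm of [H]. *)
Lemma sqr_hnorm_subi S u : symmetric_operator S -> dom S u ->
  hnorm (S u - 'i *: u) ^+ 2 = hnorm (S u) ^+ 2 + hnorm u ^+ 2.
Proof.
move=> Ssym Su; rewrite -[in RHS](hnormMi u); apply: complexI.
rewrite [RHS]rmorphD /= -!hdot_hnorm.
by rewrite hdotBl !hdotBr !(hdotZr, hdotZl) conjCi (Ssym u u)//; ring.
Qed.

Lemma linear_operatorB S u v : linear_operator S -> dom S u -> dom S v ->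
  dom S (u - v) /\ S (u - v) = S u - S v.
Proof.
move=> [[_ SD] Slin] Su Sv.
have -> : u - v = -1 *: v + u by rewrite scaleN1r addrC.
by split; [exact: SD|rewrite (Slin _ _ _ Sv Su) scaleN1r addrC].
Qed.

(** Minimality is tested near the projection on [v]; adding 1 to [|v|^2] keeps the denominator
    positive when [v = 0]. *)
Lemma hnorm_orthogonal u v :
  (forall z, hnorm u <= hnorm (u - z *: v)) -> hdot u v = 0.
Proof.
move=> umin; apply/eqP; rewrite -normr_eq0 normr_cmod.
have vE : 0 < hnorm v ^+ 2 + 1 by rewrite ltr_wpDl ?sqr_ge0.
have := umin ((hnorm v ^+ 2 + 1)^-1%:C * hdot u v).
rewrite -ler_sqr ?nnegrE ?hnorm_ge0// sqr_hnormB_proj.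
set p := cmod _ => pE.
have : p ^+ 2 <= 0.
  (* This factor is [2 s - s^2 |v|^2] at [s = (|v|^2 + 1)^-1]. *)
  rewrite -(pmulr_rle0 (x := (hnorm v ^+ 2 + 2) / (hnorm v ^+ 2 + 1) ^+ 2)).
    rewrite -subr_ge0 -(lerD2l (hnorm u ^+ 2)) addr0; apply: le_trans pE _.
    rewrite le_eqVlt; apply: predU1l.
    by field; rewrite gt_eqF.
  by rewrite divr_gt0 ?exprn_gt0// ltr_wpDl ?sqr_ge0.
by rewrite real_exprn_even_le0 ?num_real //= => /eqP ->.
Qed.

(* A minimizing sequence for the distance from [f] to the range of [S - 'i]
   converges in the graph norm, and the residual [g] at its limit is orthogonal to
   that range, i.e. [S g = - 'i g], which forces [g = 0] because [S] is symmetric. *)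
Lemma self_adjoint_subi_surjective S f : linear_operator S -> densely_defined S ->
  self_adjoint S -> exists2 u, dom S u & S u - 'i *: u = f.
Proof.
move=> Slin Sd Ssa; have Ssym := self_adjoint_symmetric Ssa.
have [[S0 SD] SL] := Slin.
pose m u := S u - 'i *: u.
have S00 : S 0 = 0 by have := SL (-1) _ _ S0 S0; rewrite !scaleN1r !addNr.
have mZ z u : dom S u -> dom S (z *: u) /\ m (z *: u) = z *: m u.
  move=> Su; have := SD z _ _ Su S0; have := SL z _ _ Su S0.
  by rewrite S00 !addr0 /m scalerBr !scalerA [z * _]mulrC => ->.
have mD u v : dom S u -> dom S v -> dom S (u + v) /\ m (u + v) = m u + m v.
  move=> Su Sv; have := SD 1 _ _ Su Sv; have := SL 1 _ _ Su Sv.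
  by rewrite !scale1r /m scalerDr opprD addrACA => ->.
pose E := [set hnorm (f - m u) ^+ 2 | u in dom S].
have E0 : E !=set0 by exists (hnorm (f - m 0) ^+ 2); exists 0.
have Einf : has_inf E.
  by split => //; exists 0 => _ [u _ <-]; exact: sqr_ge0.
pose d := inf E.
have dE u : dom S u -> d <= hnorm (f - m u) ^+ 2.
  by move=> Su; apply: ge_inf; [exact: Einf.2|exists u].
have /choice[s sP] n : exists u, dom S u /\ hnorm (f - m u) ^+ 2 < d + n.+1%:R^-1.
  have [|_ [u Su <-] ud] := @inf_adherent _ E n.+1%:R^-1 _ Einf.
    by rewrite invr_gt0.
  by exists u.
(* The residual at the midpoint of [s k] and [s n] has squared norm at least [d], so the
   parallelogram law makes the difference of the two residuals small; its norm is the graph norm of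
   [s k - s n]. *)
have sB k n : hnorm (S (s k - s n)) ^+ 2 + hnorm (s k - s n) ^+ 2 <=
    2 * (k.+1%:R^-1 + n.+1%:R^-1).
  have [[Sk dk] [Sn dn]] := (sP k, sP n).
  have [Skn SB] := linear_operatorB Slin Sk Sn.
  rewrite -sqr_hnorm_subi//.
  have -> : S (s k - s n) - 'i *: (s k - s n) = - ((f - m (s k)) - (f - m (s n))).
    rewrite opprB [RHS]addrC opprB subrKA SB /m scalerBr.
    by rewrite !opprD !opprK addrACA.
  have [SD2 mD2] := mD _ _ Sk Sn; have [Sh mh] := mZ 2^-1 _ SD2.
  set c := f - m (2^-1 *: (s k + s n)).
  have cE : f - m (s k) + (f - m (s n)) = c + c.
    rewrite /c mh mD2 addrACA [RHS]addrACA -!opprD -scalerDl.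
    rewrite (_ : 2^-1 + 2^-1 = 1) ?scale1r//; by field.
  (* With equal arguments the law reads [|c + c|^2 = 4 |c|^2]. *)
  have := hnorm_parallelogram c c.
  rewrite subrr -cE.
  have := hnorm_parallelogram (f - m (s k)) (f - m (s n)).
  have := dE _ Sh; rewrite -/c => {cE}.
  rewrite hnorm0 expr0n hnormN /= => h1 h2 h3.
  move: dk dn h1 h2 h3; move: (_^-1) (_^-1) => a b.
  by move: (_ ^+ 2) (_ ^+ 2) (_ ^+ 2) (_ ^+ 2) (_ ^+ 2) => *; lra.
have scc (e : R) : 0 < e -> exists N, forall k n, (N <= k)%N -> (N <= n)%N ->
    2 * (k.+1%:R^-1 + n.+1%:R^-1) < e ^+ 2.
  move=> e0; have e4 : 0 < e ^+ 2 / 4 by rewrite divr_gt0 ?exprn_gt0.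
  have [N _ NP] := near_infty_natSinv_lt (PosNum e4).
  exists N => k n /NP + /NP; rewrite /=.
  by move: (k.+1%:R^-1) (n.+1%:R^-1) => a b *; lra.
have [u su] : exists u, forall e : R, 0 < e ->
    \forall n \near \oo, hnorm (s n - u) < e.
  apply: hnorm_cauchy_cvg => e e0; have [N sN] := scc e e0; exists N => k n Nk Nn.
  rewrite -ltr_sqr ?nnegrE ?hnorm_ge0 ?(ltW e0)//.
  apply: (le_lt_trans _ (sN _ _ Nk Nn)); apply: (le_trans _ (sB k n)).
  by rewrite lerDr sqr_ge0.
have [v sv] : exists v, forall e : R, 0 < e ->
    \forall n \near \oo, hnorm (S (s n) - v) < e.
  apply: hnorm_cauchy_cvg => e e0; have [N sN] := scc e e0; exists N => k n Nk Nn.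
  have [Sk Sn] := ((sP k).1, (sP n).1).
  rewrite -(linear_operatorB Slin Sk Sn).2.
  rewrite -ltr_sqr ?nnegrE ?hnorm_ge0 ?(ltW e0)//.
  apply: (le_lt_trans _ (sN _ _ Nk Nn)); apply: (le_trans _ (sB k n)).
  by rewrite lerDl sqr_ge0.
(* A self-adjoint operator is closed: pass to the limit in [<S x, s n> = <x, S (s n)>]. *)
have [Su Suv] : dom S u /\ S u = v.
  apply: self_adjoint_eq => // x Sx; apply/eqP; rewrite -subr_eq0 -normr_eq0 normr_cmod.
  set c := cmod _; suff : c <= 0.
    by move=> c0; rewrite (_ : c = 0)//; apply/eqP; rewrite eq_le c0 cmod_ge0.
  apply/ler_addgt0Pr => e e0; rewrite add0r.
  pose b := hnorm (S x) + hnorm x + 1.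
  have b0 : 0 < b by rewrite ltr_wpDl// addr_ge0// hnorm_ge0.
  have [n [nu nv]] : exists n, hnorm (s n - u) < e / b /\ hnorm (S (s n) - v) < e / b.
    have eb : 0 < e / b by rewrite divr_gt0.
    by near \oo => n; exists n; split; near: n; [exact: su|exact: sv].
  have := cmod_hdot_le (S x) (s n - u); have := cmod_hdot_le x (S (s n) - v).
  have -> : c = cmod (hdot x (S (s n) - v) - hdot (S x) (s n - u)).
    by rewrite /c !hdotBr (Ssym _ _ Sx (sP n).1); congr cmod; ring.
  have := ler_cmodD (hdot x (S (s n) - v)) (- hdot (S x) (s n - u)).
  rewrite normcN => h1 h2 h3.
  have : hnorm x * hnorm (S (s n) - v) <= hnorm x * (e / b).
    by rewrite ler_wpM2l ?hnorm_ge0 ?ltW.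
  have : hnorm (S x) * hnorm (s n - u) <= hnorm (S x) * (e / b).
    by rewrite ler_wpM2l ?hnorm_ge0 ?ltW.
  have : (hnorm (S x) + hnorm x + 1) * (e / b) = e by rewrite mulrC divfK// gt_eqF.
  have : 0 < e / b by rewrite divr_gt0.
  lra.
(* The limit attains the infimum. Otherwise let [e] be a third of the gap between [a] and [sqrt d]:
   the residual at [s n] is below [sqrt d + e], and moving to [u] costs less than [2 e]. *)
have gd : hnorm (f - m u) ^+ 2 <= d.
  rewrite leNgt; apply/negP => da.
  have d0 : 0 <= d by apply: lb_le_inf => // _ [w _ <-]; exact: sqr_ge0.
  set a := hnorm _ in da.
  have ra : Num.sqrt d < a by rewrite -ltr_sqr ?nnegrE ?sqrtr_ge0 ?hnorm_ge0// sqr_sqrtr.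
  pose e := (a - Num.sqrt d) / 3.
  have e0 : 0 < e by rewrite divr_gt0 ?subr_gt0.
  have [n [[ne nu] nv]] : exists n,
      (n.+1%:R^-1 < e ^+ 2 /\ hnorm (s n - u) < e) /\ hnorm (S (s n) - v) < e.
    have e20 : 0 < e ^+ 2 by rewrite exprn_gt0.
    near \oo => n; exists n; split; [split|]; near: n; [|exact: su|exact: sv].
    exact: (near_infty_natSinv_lt (PosNum e20)).
  have nf : hnorm (f - m (s n)) < Num.sqrt d + e.
    rewrite -ltr_sqr ?nnegrE ?hnorm_ge0 ?addr_ge0 ?sqrtr_ge0 ?(ltW e0)//.
    rewrite sqrrD (sqr_sqrtr d0); apply: (lt_le_trans (sP n).2).
    apply: (le_trans (lerD (lexx d) (ltW ne))).
    by rewrite lerD2r lerDl mulrn_wge0 // mulr_ge0 ?sqrtr_ge0// ltW.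
  have : a <= hnorm (f - m (s n)) + (hnorm (S (s n) - v) + hnorm (s n - u)).
    rewrite /a /m Suv -(hnormMi (s n - u)) -(hnormN ('i *: _)).
    apply: le_trans (lerD (lexx _) (hnormD _ _)); apply: le_trans (hnormD _ _).
    rewrite le_eqVlt; apply: predU1l; congr hnorm.
    rewrite [S (s n) - v + _](_ : _ = S (s n) - 'i *: s n - (v - 'i *: u)) ?subrKA//.
    by rewrite scalerBr !opprD !opprK addrACA.
  rewrite /e in nf nu nv; lra.
have gm w : dom S w -> hdot (f - m u) (m w) = 0.
  move=> Sw; apply: hnorm_orthogonal => z.
  have [Szw mzw] := mZ z w Sw; have [Suw muw] := mD _ _ Su Szw.
  rewrite -mzw -addrA -opprD -muw -ler_sqr ?nnegrE ?hnorm_ge0//.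
  exact: le_trans gd (dE _ Suw).
(* Conjugating the orthogonality relation gives [<S x, g> = <x, - 'i g>] for the residual [g] and
   all [x] in [dom S]. *)
have [Sg gE] : dom S (f - m u) /\ S (f - m u) = - 'i *: (f - m u).
  apply: self_adjoint_eq => // x Sx.
  have := gm x Sx; rewrite hdotC hdotZr => /eqP; rewrite conjC_eq0 hdotBl hdotZl.
  by rewrite subr_eq0 rmorphN /= conjCi opprK => /eqP.
exists u => //; apply/esym/eqP; rewrite -subr_eq0; apply/eqP/hnorm0_eq0.
(* Symmetry equates [- 'i |g|^2] with ['i |g|^2]. *)
have := Ssym _ _ Sg Sg; rewrite gE hdotZl hdotZr rmorphN /= conjCi opprK mulNr => /eqP.
rewrite -subr_eq0 -opprD oppr_eq0 -mulr2n mulrn_eq0 mulf_eq0 (negPf (neq0Ci _)) /=.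
by rewrite -sqr_norm_hdot sqrf_eq0 normr_hnorm => /eqP [].
Unshelve. all: by end_near.
Qed.

End SelfAdjoint.

(** * Operator norms and an epsilon form of convergence *)

Section Opnorm.
Context {R : realType}.
Implicit Types c e t : R.

Lemma le_opnorm (V W : Type) (D : set V) (ipV : V -> V -> R[i]) (ipW : W -> W -> R[i])
    (T : V -> W) c u : D u -> dot_norm ipV u <= 1 -> (opnorm D ipV ipW T <= c%:E)%E ->
  dot_norm ipW (T u) <= c.
Proof.
move=> Du u1; rewrite -lee_fin; apply: le_trans.
by apply: ereal_sup_ubound; exists u.
Qed.

Lemma opnorm_le (V W : Type) (D : set V) (ipV : V -> V -> R[i]) (ipW : W -> W -> R[i])
    (T : V -> W) c :
  (forall u, D u -> dot_norm ipV u <= 1 -> dot_norm ipW (T u) <= c) ->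
  (opnorm D ipV ipW T <= c%:E)%E.
Proof.
by move=> Tc; apply: ge_ereal_sup => _ [u [Du u1] <-]; rewrite lee_fin; exact: Tc.
Qed.

(* The witness [u] only makes the supremum range over a nonempty set: the supremum
   of the empty set is -oo. *)
Lemma cvg_opnorm01P (V : Type) (W : zmodType) (D : set V) (ipV : V -> V -> R[i])
    (ipW : W -> W -> R[i]) (T : R -> V -> W) t0 u :
  D u -> dot_norm ipV u <= 1 ->
  (cvg_opnorm01 D ipV ipW T t0 <->
   forall e, 0 < e -> \forall t \near nbhs t0, t \in `[0, 1] ->
     (opnorm D ipV ipW (fun v => (T t v - T t0 v)%R) <= e%:E)%E).
Proof.
move=> Du u1; split=> [Tt0 e e0|Tt0 U /= [e /= e0 eU]].
  have /Tt0 : nbhs (0%E : \bar R) [set x | (x <= e%:E)%E].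
    exists e => //= r /=; rewrite sub0r normrN lee_fin => re.
    by rewrite ltW// (le_lt_trans (ler_norm r)).
  by move=> h; exact: h.
(* Halving turns the non-strict bound on the norm into the strict one of a ball. *)
have e20 : 0 < e / 2 by rewrite divr_gt0.
suff : \forall t \near nbhs t0, t \in `[0, 1] ->
  U (opnorm D ipV ipW (fun v => (T t v - T t0 v)%R)) by [].
apply: filterS (Tt0 _ e20) => t Tt /Tt.
have : (0 <= opnorm D ipV ipW (fun v => (T t v - T t0 v)%R))%E.
  apply: le_trans (ereal_sup_ubound _); last by exists u; [split; eassumption|].
  by rewrite lee_fin sqrtr_ge0.
move: (opnorm _ _ _ _) => [r| |] //=; rewrite !lee_fin => r0 re.
apply: eU; rewrite /= sub0r normrN ger0_norm//.
by apply: le_lt_trans re _; rewrite ltr_pdivrMr// ltr_pMr// ltr1n.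
Qed.

End Opnorm.

(** * Norms on [G * G] and estimates for the symplectic form *)

Section ProductSpace.
Context {R : realType} {G : hilbertType R}.
Implicit Types x y : G * G.

(* Equivalent to the norm of [prod_dot], but with an immediate triangle inequality. *)
Definition sum_norm x : R := hnorm x.1 + hnorm x.2.

Lemma sum_norm_ge0 x : 0 <= sum_norm x.
Proof. by rewrite addr_ge0 ?hnorm_ge0. Qed.

Lemma sum_normD x y : sum_norm (x + y) <= sum_norm x + sum_norm y.
Proof. by rewrite /sum_norm addrACA lerD ?hnormD. Qed.

Lemma sum_normN x : sum_norm (- x) = sum_norm x.
Proof. by rewrite /sum_norm !hnormN. Qed.

Lemma prod_dot_norm x :
  dot_norm (@prod_dot R G) x = Num.sqrt (hnorm x.1 ^+ 2 + hnorm x.2 ^+ 2).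
Proof. by rewrite [LHS]/dot_norm /prod_dot !hdot_hnorm. Qed.

Lemma prod_dot_normZ (r : R) x : 0 <= r ->
  dot_norm (@prod_dot R G) (r%:C *: x) = r * dot_norm (@prod_dot R G) x.
Proof.
move=> r0; have rE : cmod r%:C = r.
  by apply: complexI; rewrite -normr_cmod ger0_norm// ler0c.
rewrite !prod_dot_norm /= !hnormZ rE !exprMn -mulrDr sqrtrM ?sqr_ge0//.
by rewrite sqrtr_sqr ger0_norm.
Qed.

Lemma sum_norm_le x : sum_norm x <= 2 * dot_norm (@prod_dot R G) x.
Proof.
have h (a b : R) : 0 <= a -> a <= Num.sqrt (a ^+ 2 + b ^+ 2).
  by move=> a0; rewrite -{1}(ger0_norm a0) -sqrtr_sqr ler_wsqrtr// lerDl sqr_ge0.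
rewrite prod_dot_norm mulr_natl mulr2n lerD ?h ?hnorm_ge0//.
by rewrite addrC h ?hnorm_ge0.
Qed.

Lemma omegaBl x1 x2 y : omega (x1 - x2) y = omega x1 y - omega x2 y :> R[i].
Proof. rewrite /omega !hdotBl; ring. Qed.

Lemma omegaBr x y1 y2 : omega x (y1 - y2) = omega x y1 - omega x y2 :> R[i].
Proof. rewrite /omega !hdotBr; ring. Qed.

Lemma cmod_omega_le x y : cmod (omega x y) <= sum_norm x * sum_norm y.
Proof.
apply: le_trans (ler_cmodD _ _) _; rewrite normcN.
apply: le_trans (lerD (cmod_hdot_le _ _) (cmod_hdot_le _ _)) _.
rewrite /sum_norm mulrDl !mulrDr.
have := hnorm_ge0 x.1; have := hnorm_ge0 x.2.
have := hnorm_ge0 y.1; have := hnorm_ge0 y.2.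
nra.
Qed.

(** Substituting [y = x - d] in [omega y y = 0] leaves only terms of [omega x x] that contain
    [d]. *)
Lemma omega_near_isotropic x y : omega y y = 0 ->
  cmod (omega x x) <= sum_norm (x - y) * (2 * sum_norm x + sum_norm (x - y)).
Proof.
set d := x - y => yy.
have -> : omega x x = omega x d + (omega d x - omega d d).
  by rewrite /d !(omegaBl, omegaBr) yy; ring.
apply: le_trans (ler_cmodD _ _) _; apply: le_trans (lerD (lexx _) (ler_cmodD _ _)) _.
rewrite normcN.
have := cmod_omega_le x d; have := cmod_omega_le d x; have := cmod_omega_le d d.
lra.
Qed.

Lemma lagrangian_isotropic (L : set (G * G)) x y : lagrangian L -> L x -> L y ->
  omega x y = 0.
Proof. by rewrite /lagrangian => LE; rewrite {1}LE /= => Lx /Lx. Qed.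

End ProductSpace.

(** * Resolvents of self-adjoint extensions in the graph norm *)

Section Resolvent.
Context {R : realType} {H : hilbertType R}.
Implicit Types (A S : operator H).

(** Surjectivity of [S - 'i] supplies the witness that [xget] requires. *)
Lemma resolventP S f : linear_operator S -> densely_defined S -> self_adjoint S ->
  dom S (resolvent S 'i f) /\ S (resolvent S 'i f) - 'i *: resolvent S 'i f = f.
Proof.
move=> Slin Sd Ssa; have [u Su uE] := self_adjoint_subi_surjective f Slin Sd Ssa.
by apply: (@xgetPex _ 0 [set u | dom S u /\ S u - 'i *: u = f]); exists u.
Qed.

Lemma densely_defined_extends A S : densely_defined A -> extends A S ->
  densely_defined S.
Proof.
move=> Ad [AS _] O O0 Oo; have [x [Ox Ax]] := Ad O O0 Oo.
by exists x; split=> //; exact: AS.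
Qed.

Lemma graph_dot_norm A u :
  dot_norm (graph_dot A) u = Num.sqrt (hnorm u ^+ 2 + hnorm (adjoint A u) ^+ 2).
Proof. by rewrite [LHS]/dot_norm /graph_dot !hdot_hnorm. Qed.

(** On [dom S] the graph norms of [A^*] and [S] agree, so the resolvent is isometric into the graph
    norm. This gives a bound common to all extensions. *)
Lemma extension_resolventP A S f : densely_defined A -> linear_operator S ->
  self_adjoint S -> extends A S -> let u := resolvent S 'i f in
  [/\ dom S u, dom (adjoint A) u, adjoint A u = f + 'i *: u &
      dot_norm (graph_dot A) u = hnorm f].
Proof.
move=> Ad Slin Ssa AS u.
have [Su Sf] := resolventP f Slin (densely_defined_extends Ad AS) Ssa.
have [A'u A'E] := extends_adjoint Ad Ssa AS Su.
split=> //; first by rewrite A'E -[in RHS]Sf subrK.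
rewrite graph_dot_norm A'E addrC -(sqr_hnorm_subi (self_adjoint_symmetric Ssa) Su).
by rewrite Sf sqrtr_sqr ger0_norm ?hnorm_ge0.
Qed.

Lemma adjointB A u v : densely_defined A -> dom (adjoint A) u -> dom (adjoint A) v ->
  dom (adjoint A) (u - v) /\ adjoint A (u - v) = adjoint A u - adjoint A v.
Proof.
by move=> Ad A'u A'v; apply: adjoint_eq => // x Ax; rewrite !hdotBr !adjoint_hdot.
Qed.

End Resolvent.

(** * Green's identity on the deficiency space and homogeneity of operator bounds *)

Section BoundaryTriplet.
Context {R : realType} {H G : hilbertType R}.
Implicit Types (A : operator H).

(** Green's identity with both arguments [w] has left side [2 'i |w|^2]; then take moduli. *)
Lemma deficiency_green A Gamma0 Gamma1 w : @boundary_triplet R H G A Gamma0 Gamma1 ->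
  dom (adjoint A) w -> adjoint A w = 'i *: w ->
  2 * hnorm w ^+ 2 =
  cmod (omega (trace_op Gamma0 Gamma1 w) (trace_op Gamma0 Gamma1 w)).
Proof.
move=> [_ _ green] A'w wE; rewrite /omega /= -green// wE hdotZl hdotZr conjCi mulNr.
rewrite opprK -mulrDl hdot_hnorm -mulr2n; apply: complexI.
rewrite -normr_cmod normrM normrMn normCi ger0_norm ?ler0c ?sqr_ge0//.
by rewrite rmorphM rmorph_nat.
Qed.

Lemma trace_opB A Gamma0 Gamma1 u v : @boundary_triplet R H G A Gamma0 Gamma1 ->
  dom (adjoint A) u -> dom (adjoint A) v ->
  trace_op Gamma0 Gamma1 (u - v) = trace_op Gamma0 Gamma1 u - trace_op Gamma0 Gamma1 v.
Proof.
move=> [[Tlin _] _ _] A'u A'v.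
have -> : u - v = -1 *: v + u by rewrite scaleN1r addrC.
by rewrite (Tlin _ _ _ A'v A'u) scaleN1r addrC.
Qed.

(** Rescale by [M^-1] into the unit ball. A positive upper bound [M] in place of the norm of [x]
    also covers [x = 0]. *)
Lemma scalable_opnorm_le (T : (G * G)%type -> (G * G)%type) (c M : R) x :
  scalable T -> 0 < M -> dot_norm (@prod_dot R G) x <= M ->
  (opnorm setT (@prod_dot R G) (@prod_dot R G) T <= c%:E)%E ->
  dot_norm (@prod_dot R G) (T x) <= c * M.
Proof.
move=> Tlin M0 xM Tc; have Mi0 : 0 <= M^-1 by rewrite invr_ge0 ltW.
rewrite -ler_pdivrMr// mulrC -prod_dot_normZ// -Tlin.
apply: (le_opnorm _ _ Tc) => //; rewrite prod_dot_normZ//.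
by rewrite mulrC ler_pdivrMr// mul1r.
Qed.

End BoundaryTriplet.

(** * Quantitative comparison of two resolvents *)

Section Convergence.
Context {R : realType} {H G : hilbertType R}.

(** Index 0 stands for [t0] and index 1 for [t]. The bound is on the square of the norm, linear in
    [e] and uniform over [f] in the unit ball. *)
Lemma resolvent_sub_le (A S0 S1 : operator H) (Gamma00 Gamma01 Gamma10 Gamma11 : H -> G)
    (Q0 Q1 : {linear (G * G)%type -> (G * G)%type}) (c e : R) f :
  densely_defined A ->
  linear_operator S0 -> self_adjoint S0 -> extends A S0 ->
  linear_operator S1 -> self_adjoint S1 -> extends A S1 ->
  boundary_triplet A Gamma10 Gamma11 ->
  (forall x, Q0 (Q0 x) = Q0 x) -> lagrangian (range Q1) ->
  trace_op Gamma00 Gamma01 @` dom S0 = range Q0 ->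
  trace_op Gamma10 Gamma11 @` dom S1 = range Q1 ->
  0 <= c -> 0 <= e <= 1 ->
  (opnorm (dom (adjoint A)) (graph_dot A) (@prod_dot R G)
    (trace_op Gamma00 Gamma01) <= c%:E)%E ->
  (opnorm (dom (adjoint A)) (graph_dot A) (@prod_dot R G)
    (fun u => trace_op Gamma10 Gamma11 u - trace_op Gamma00 Gamma01 u)%R <= e%:E)%E ->
  (opnorm setT (@prod_dot R G) (@prod_dot R G) (fun x => Q1 x - Q0 x)%R <= e%:E)%E ->
  hnorm f <= 1 ->
  dot_norm (graph_dot A) (resolvent S1 'i f - resolvent S0 'i f) ^+ 2 <=
    20 * (c + 2) ^+ 2 * e.
Proof.
move=> Ad S0lin S0sa AS0 S1lin S1sa AS1 bt Q0K Q1L TQ0 TQ1 c0 /andP[e0 e1] Tc Te Qe f1.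
have [] := extension_resolventP f Ad S0lin S0sa AS0.
have [] := extension_resolventP f Ad S1lin S1sa AS1.
set u1 := resolvent S1 'i f; set u0 := resolvent S0 'i f.
move=> Su1 A'u1 A'u1E u1f Su0 A'u0 A'u0E u0f; pose w := u1 - u0.
have u11 : dot_norm (graph_dot A) u1 <= 1 by rewrite u1f.
have u01 : dot_norm (graph_dot A) u0 <= 1 by rewrite u0f.
have [A'w wE] := adjointB Ad A'u1 A'u0; rewrite -/w in A'w wE.
have {}wE : adjoint A w = 'i *: w.
  by rewrite wE A'u1E A'u0E /w scalerBr opprD addrACA subrr add0r.
(* On the kernel of [A^* - 'i] the squared graph norm is exactly the left side of
   [deficiency_green]. *)
have -> : dot_norm (graph_dot A) w ^+ 2 = 2 * hnorm w ^+ 2.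
  rewrite graph_dot_norm wE hnormMi sqr_sqrtr ?addr_ge0 ?sqr_ge0//; ring.
rewrite (deficiency_green bt A'w wE) (trace_opB bt A'u1 A'u0).
set T1 := trace_op Gamma10 Gamma11; set T0 := trace_op Gamma00 Gamma01.
(* The isotropic vector near [T1 w]: both of its terms lie in the range of [Q1]. *)
pose z := T1 u1 - Q1 (T0 u0).
have zQ1 : range Q1 z.
  have [x _ xE] : range Q1 (T1 u1) by rewrite -TQ1; exists u1.
  by exists (x - T0 u0) => //; rewrite linearB xE.
have Q0T0 : Q0 (T0 u0) = T0 u0.
  have [x _ xE] : range Q0 (T0 u0) by rewrite -TQ0; exists u0.
  by rewrite -xE Q0K.
(* The bound [c + 1] is positive even if [c = 0], as the rescaling in [Qd] demands. *)
have T0u0 : dot_norm (@prod_dot R G) (T0 u0) <= c + 1.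
  by apply: le_trans (le_opnorm A'u0 u01 Tc) _; rewrite lerDl.
have T0u1 := le_opnorm A'u1 u11 Tc.
have d0 := le_opnorm A'u0 u01 Te; have d1 := le_opnorm A'u1 u11 Te.
have Qd : dot_norm (@prod_dot R G) (Q1 (T0 u0) - Q0 (T0 u0)) <= e * (c + 1).
  apply: (scalable_opnorm_le (T := fun x => Q1 x - Q0 x)) => //; last by rewrite ltr_wpDl.
  by move=> a x; rewrite !linearZ /= scalerBr scalerN.
have h := omega_near_isotropic (T1 u1 - T1 u0) (lagrangian_isotropic Q1L zQ1 zQ1).
apply: le_trans h _.
have zE : T1 u1 - T1 u0 - z = (Q1 (T0 u0) - Q0 (T0 u0)) - (T1 u0 - T0 u0).
  by rewrite Q0T0 /z opprB addrC subrKA opprB subrKA.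
have zN : sum_norm (T1 u1 - T1 u0 - z) <= 2 * ((c + 2) * e).
  rewrite zE; apply: le_trans (sum_normD _ _) _; rewrite sum_normN.
  apply: le_trans (lerD (sum_norm_le _) (sum_norm_le _)) _.
  rewrite -mulrDr ler_pM2l//; apply: le_trans (lerD Qd d0) _.
  by rewrite le_eqVlt; apply: predU1l; ring.
(* Here [e <= 1] absorbs the perturbation into the constant [c + 2]. *)
have T1N u : dot_norm (@prod_dot R G) (T1 u - T0 u) <= e ->
    dot_norm (@prod_dot R G) (T0 u) <= c + 1 -> sum_norm (T1 u) <= 2 * (c + 2).
  move=> ud u0'; rewrite -(subrK (T0 u) (T1 u)); apply: le_trans (sum_normD _ _) _.
  apply: le_trans (lerD (sum_norm_le _) (sum_norm_le _)) _.
  rewrite -mulrDr ler_pM2l//; apply: le_trans (lerD ud u0') _; lra.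
have wN : sum_norm (T1 u1 - T1 u0) <= 4 * (c + 2).
  apply: le_trans (sum_normD _ _) _; rewrite sum_normN.
  have := T1N _ d0 T0u0; have := T1N _ d1 (le_trans T0u1 _).
  rewrite lerDl => /(_ ler01); lra.
have := sum_norm_ge0 (T1 u1 - T1 u0); have := sum_norm_ge0 (T1 u1 - T1 u0 - z).
have ce : (c + 2) * e <= c + 2 by rewrite ler_piMr// addr_ge0.
move: (sum_norm _) (sum_norm _) zN wN => p q ph qh p0 q0.
(* The second factor is at most [2 * 4 (c + 2) + 2 (c + 2) e], hence at most [10 (c + 2)]. *)
apply: (@le_trans _ _ (2 * ((c + 2) * e) * (10 * (c + 2)))).
  by apply: ler_pM => //; lra.
by rewrite le_eqVlt; apply: predU1l; ring.
Qed.

End Convergence.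

(** * Norm convergence of the resolvents *)

Theorem proposition4p4 (R : realType) (H G : hilbertType R)
    (A : operator H) (Gamma0 Gamma1 : R -> H -> G)
    (Q : R -> {linear (G * G)%type -> (G * G)%type})
    (cA : R -> operator H) (t0 : R) :
  separable H -> separable G ->
  linear_operator A -> densely_defined A -> closed_operator A ->
  symmetric_operator A -> equal_deficiency_indices A ->
  (forall t : R, t \in `[0, 1] ->
     [/\ boundary_triplet A (Gamma0 t) (Gamma1 t),
         orthogonal_projection (Q t) /\ lagrangian (range (Q t)),
         [/\ linear_operator (cA t), self_adjoint (cA t) & extends A (cA t)] &
         trace_op (Gamma0 t) (Gamma1 t) @` dom (cA t) = range (Q t)]) ->
  t0 \in `[0, 1] ->
  cvg_opnorm01 setT (@prod_dot R G) (@prod_dot R G) (fun t => Q t) t0 ->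
  cvg_opnorm01 (dom (adjoint A)) (graph_dot A) (@prod_dot R G)
    (fun t => trace_op (Gamma0 t) (Gamma1 t)) t0 ->
  cvg_opnorm01 setT (@hdot R H) (graph_dot A) (fun t => resolvent (cA t) 'i) t0.
Proof.
move=> _ _ _ Ad _ _ _ At t01 Qt0 Tt0.
(* The zero vector serves as the unit-ball witness for all three convergences. *)
have [A'0 A'0E] : dom (adjoint A) 0 /\ adjoint A 0 = 0.
  by apply: adjoint_eq => // u _; rewrite !linear0r.
have g0 : dot_norm (graph_dot A) 0 <= 1.
  by rewrite graph_dot_norm A'0E hnorm0 expr0n addr0 sqrtr0.
have h0 : hnorm (0 : H) <= 1 by rewrite hnorm0.
have p0 : dot_norm (@prod_dot R G) 0 <= 1.
  by rewrite prod_dot_norm hnorm0 expr0n addr0 sqrtr0.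
apply/(cvg_opnorm01P _ _ _ (u := 0)) => // e e0.
have [[[_ Tfin] _ _] [[Q0K _] _] [S0lin S0sa AS0] TQ0] := At _ t01.
have [c c0 Tc] : exists2 c, 0 <= c & (opnorm (dom (adjoint A)) (graph_dot A)
    (@prod_dot R G) (trace_op (Gamma0 t0) (Gamma1 t0)) <= c%:E)%E.
  move: Tfin; move: (opnorm _ _ _ _) => [r| |] // _; last by exists 0; rewrite // leNye.
  (* The maximum with 0 secures the sign of [c]. *)
  by exists (Num.max 0 r); rewrite ?lee_fin le_max lexx ?orbT.
pose K := 20 * (c + 2) ^+ 2.
have K0 : 0 < K by rewrite mulr_gt0// exprn_gt0// ltr_wpDl.
(* Chosen so that [d <= 1], as the estimate requires, and [K * d <= e ^+ 2]. *)
pose d := Num.min 1 (e ^+ 2 / K).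
have d0 : 0 < d by rewrite lt_min ltr01 divr_gt0// exprn_gt0.
have Tt := (cvg_opnorm01P _ _ _ A'0 g0).1 Tt0 d d0.
have Qt := (cvg_opnorm01P _ _ _ (I : setT 0) p0).1 Qt0 d d0.
apply: filterS2 Tt Qt => t Tt Qt tI.
have [bt [_ Q1L] [S1lin S1sa AS1] TQ1] := At _ tI.
apply: opnorm_le => f _ f1.
rewrite -ler_sqr ?nnegrE ?(ltW e0) ?sqrtr_ge0//.
apply: (@le_trans _ _ (K * d)).
  apply: (resolvent_sub_le (Q0 := Q t0) (Q1 := Q t) Ad _ _ _ _ _ _ bt _ _ TQ0 TQ1) => //.
  - by rewrite (ltW d0) ge_min lexx.
  - exact: Tt.
  - exact: Qt.
by rewrite mulrC -ler_pdivlMr// ge_min lexx orbT.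
Qed.
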